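(* Let $x_0>x_1$ be positive integers. The regular Euclidean algorithm for $(x_0,x_1)$ gives the least number of steps among all general Euclidean algorithms for $(x_0,x_1)$.
   Context: Let $x_0>x_1$ be positive integers. A general Euclidean algorithm for the pair $(x_0,x_1)$ is a finite list of $m\ge 1$ equations $$x_{i-1}=x_i p_i+\epsilon_{i+1}x_{i+1}\quad (1\le i\le m-1),\qquad x_{m-1}=x_m p_m,$$ where all $x_i$ are positive integers with $x_{i+1}<x_i$ for all $0\le i\le m-1$, all $p_i$ are positive integers, and each $\epsilon_i\in\{+1,-1\}$ $(2\le i\le m)$. (If $x_1$ divides $x_0$ the list consists of the single equation $x_0=x_1p_1$.) The number of steps of such an algorithm is $(m-1)+\sum_{i=1}^m p_i$ (each subtraction counts as one step, and each passage from the pair $(x_{i-1},x_i)$ to the pair $(x_i,x_{i+1})$ counts as one step). The regular Euclidean algorithm is the general Euclidean algorithm in which all $\epsilon_i=+1$. *)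

(* Defs.v *)
From HB Require Import structures.
From mathcomp Require Import all_boot all_order all_algebra.

Set Implicit Arguments.
Unset Strict Implicit.
Unset Printing Implicit Defensive.

Import GRing.Theory Num.Theory.

(* The data of a list of m division equations: remainders x_0, ..., x_m,
   quotients p_1, ..., p_m and signs epsilon_2, ..., epsilon_m.  Finite
   sequences are used, rather than functions on nat, so that Leibniz equality
   of records is equality of algorithms. *)
Record euclid_data := EuclidData {
  remainders : seq nat;
  quotients : seq nat;
  signs : seq int
}.

Section Accessors.
Variable A : euclid_data.

Definition nb_eqs : nat := size (quotients A).

(* The indices shift because the quotients are numbered from 1 and the signs
   from 2; only x_i with i <= m, p_i with 1 <= i <= m and epsilon_i with
   2 <= i <= m are meaningful. *)
Definition rem_ (i : nat) : nat := nth 0 (remainders A) i.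
Definition quo_ (i : nat) : nat := nth 0 (quotients A) i.-1.
Definition sgn_ (i : nat) : int := nth 0%R (signs A) i.-2.

End Accessors.

Record general_euclid (x0 x1 : nat) (A : euclid_data) : Prop := GeneralEuclid {
  nb_eqs_gt0 : 1 <= nb_eqs A;
  size_remainders : size (remainders A) = (nb_eqs A).+1;
  size_signs : size (signs A) = (nb_eqs A).-1;
  rem_0 : rem_ A 0 = x0;
  rem_1 : rem_ A 1 = x1;
  rem_gt0 : forall i, i <= nb_eqs A -> 0 < rem_ A i;
  rem_decr : forall i, i < nb_eqs A -> rem_ A i.+1 < rem_ A i;
  quo_gt0 : forall i, 1 <= i <= nb_eqs A -> 0 < quo_ A i;
  sgn_pm1 : forall i, 2 <= i <= nb_eqs A -> sgn_ A i = 1%R \/ sgn_ A i = (-1)%R;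
  (* over int, as epsilon_(i+1) may be -1 *)
  step_eq : forall i, 1 <= i < nb_eqs A ->
    ((rem_ A i.-1)%:Z = (rem_ A i)%:Z * (quo_ A i)%:Z
                        + sgn_ A i.+1 * (rem_ A i.+1)%:Z)%R;
  last_eq : rem_ A (nb_eqs A).-1 = rem_ A (nb_eqs A) * quo_ A (nb_eqs A)
}.

Definition regular_euclid (x0 x1 : nat) (A : euclid_data) : Prop :=
  general_euclid x0 x1 A /\
  (forall i, 2 <= i <= nb_eqs A -> sgn_ A i = 1%R).

Definition nb_steps (A : euclid_data) : nat :=
  (nb_eqs A).-1 + \sum_(1 <= i < (nb_eqs A).+1) quo_ A i.

(* Main.v *)
(* Write R(a, b) for the number of steps of the regular algorithm on (a, b).
   Removing one subtraction gives R(a + b, b) = R(a, b) + 1, and R(a, b) =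
   R(b, a) + 1 when a < b (a null division followed by a swap).  Hence
   R(b, r) <= R(b, b - r) + 1 for 0 < r < b.  A division with sign -1 replaces
   (q, r) by (q + 1, b - r), so it costs one more subtraction and spares at most
   one step afterwards; induction on the general algorithm concludes. *)
Require Import Defs.
From mathcomp Require Import all_boot all_order all_algebra.
From mathcomp Require Import zify.

Set Implicit Arguments.
Unset Strict Implicit.
Unset Printing Implicit Defensive.

(** * Inductive form of the algorithms *)

Definition cons_eq (a p : nat) (s : int) (A : euclid_data) : euclid_data :=
  EuclidData (a :: remainders A) (p :: quotients A) (s :: signs A).

(** Replaces index conditions by structural induction on the list of equations. The parameter [S]
    constrains the signs, so that one predicate covers both the regular and the general case. In
    [run_last], [1 < p] expresses that x_m < x_(m-1). *)
Inductive run (S : int -> Prop) : nat -> nat -> euclid_data -> Prop :=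
| run_last b p : 0 < b -> 1 < p ->
    run S (b * p) b (EuclidData [:: b * p; b] [:: p] [::])
| run_step a b c p s A : c < b -> b < a -> 0 < p -> S s ->
    (a%:Z = b%:Z * p%:Z + s * c%:Z)%R -> run S b c A ->
    run S a b (cons_eq a p s A).

Lemma run_gt0 S a b A : run S a b A -> 0 < b.
Proof. by case=> // *; lia. Qed.

Lemma run_of_general (S : int -> Prop) a b A :
  general_euclid a b A ->
  (forall i, 2 <= i <= nb_eqs A -> S (sgn_ A i)) -> run S a b A.
Proof.
case: A => xs ps ss.
elim: ps a b xs ss => [|p ps IH] a b xs ss [] //=.
rewrite /nb_eqs /rem_ /quo_ /sgn_ /=.
case: xs => [|x0 [|x1 xs]] //= _ [sz_xs] sz_ss E0 E1 xs_gt0 xs_decr ps_gt0 ss1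
  eqs eq_last S_ss.
subst x0 x1.
case: ps IH sz_xs sz_ss xs_gt0 xs_decr ps_gt0 ss1 eqs eq_last S_ss
  => [|p' ps] IH /= sz_xs sz_ss xs_gt0 xs_decr ps_gt0 ss1 eqs eq_last S_ss.
  have b_gt0 := xs_gt0 1 isT; have b_lt_a := xs_decr 0 isT.
  case: xs sz_xs {xs_gt0 xs_decr eqs} b_gt0 b_lt_a eq_last
    => //= _ b_gt0 b_lt_a eq_last.
  case: ss sz_ss {ss1 S_ss} => // _.
  rewrite eq_last; apply: run_last => //; move: b_lt_a; rewrite eq_last; nia.
case: xs sz_xs xs_gt0 xs_decr eqs eq_last => //= c xs [sz_xs] xs_gt0 xs_decr
  eqs eq_last.
case: ss sz_ss ss1 S_ss eqs => //= s ss [sz_ss] ss1 S_ss eqs.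
apply: (@run_step S a b c p s (EuclidData [:: b, c & xs] (p' :: ps) ss)).
- exact: (xs_decr 1).
- exact: (xs_decr 0).
- exact: (ps_gt0 1).
- exact: (S_ss 2).
- exact: (eqs 1).
apply: IH.
- split=> //=; rewrite /nb_eqs /rem_ /quo_ /sgn_ /=.
  + by rewrite sz_xs.
  + by move=> i le_i; apply: (xs_gt0 i.+1).
  + by move=> i lt_i; apply: (xs_decr i.+1).
  + by case=> // i lt_i; apply: (ps_gt0 i.+2).
  + by case=> [|[|i]] // lt_i; apply: (ss1 i.+3).
  + by case=> // i lt_i; apply: (eqs i.+2).
- by case=> [|[|i]] // lt_i; apply: (S_ss i.+3).
Qed.

Lemma general_last b p : 0 < b -> 1 < p ->
  general_euclid (b * p) b (EuclidData [:: b * p; b] [:: p] [::]).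
Proof.
move=> b_gt0 p_gt1; split=> //; rewrite /nb_eqs /rem_ /quo_ /sgn_ /=.
- by case=> [|[|i]] //= _; nia.
- by case=> [|i] //= _; nia.
- by case=> [|[|i]] //= _; lia.
- by case=> [|[|i]].
- by case=> [|[|i]].
Qed.

Lemma general_cons a b c p s A :
  b < a -> 0 < p -> s = 1%R \/ s = (-1)%R ->
  (a%:Z = b%:Z * p%:Z + s * c%:Z)%R ->
  general_euclid b c A -> general_euclid a b (cons_eq a p s A).
Proof.
move=> b_lt_a p_gt0 s1 eq_a; case: A => xs ps ss [].
rewrite /nb_eqs /rem_ /quo_ /sgn_ /=.
move=> sz_ps sz_xs sz_ss E0 E1 xs_gt0 xs_decr ps_gt0 ss1 eqs eq_last.
split; rewrite /nb_eqs /rem_ /quo_ /sgn_ //=.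
- by rewrite sz_xs.
- by rewrite sz_ss prednK.
- by case=> [|i] /= le_i; [lia | apply: xs_gt0].
- by case=> [|i] /= lt_i; [rewrite E0 | apply: xs_decr].
- by case=> [|[|i]] //= lt_i; apply: (ps_gt0 i.+1).
- by case=> [|[|[|i]]] //= lt_i; apply: (ss1 i.+2).
- case=> [|[|i]] //= lt_i; first by rewrite E0 E1.
  exact: (eqs i.+1).
- by case: (size ps) sz_ps eq_last.
Qed.

Lemma regular_of_run a b A : run (eq 1%R) a b A -> regular_euclid a b A.
Proof.
elim=> {a b A} [b p b_gt0 p_gt1 | a b c p s A _ b_lt_a p_gt0 <- eq_a _ [gA sA]].
  by split; [exact: general_last | case=> [|[|i]]].
split; first by apply: general_cons eq_a gA => //; left.
by case=> [|[|[|i]]] // lt_i; apply: (sA i.+2).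
Qed.

Lemma run_of_regular a b A : regular_euclid a b A -> run (eq 1%R) a b A.
Proof. by case=> gA sA; apply: run_of_general gA _ => i /sA. Qed.

(** * Step counts *)

Lemma nb_steps_last xs p : nb_steps (EuclidData xs [:: p] [::]) = p.
Proof. by rewrite /nb_steps /nb_eqs /= big_nat1. Qed.

Lemma nb_steps_cons S a b c p s A :
  run S b c A -> nb_steps (cons_eq a p s A) = p + (nb_steps A).+1.
Proof.
(* Positivity keeps the predecessor in [nb_steps A] from truncating, so the new equation adds
   exactly one passage. *)
move=> rA; have A_gt0 : 0 < nb_eqs A by case: rA.
rewrite /nb_steps.
have -> : nb_eqs (cons_eq a p s A) = (nb_eqs A).+1 by [].
rewrite big_nat_recl // big_add1 /= [quo_ _ 1]/=.
have -> : \sum_(1 <= i < (nb_eqs A).+1) quo_ A i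
        = \sum_(0 <= i < nb_eqs A) quo_ (cons_eq a p s A) i.+2.
  by rewrite big_add1.
by rewrite {1}/quo_ /= -{1}(prednK A_gt0); lia.
Qed.

(** Unlike [general_euclid], this count also makes sense for a < b, where the first quotient is 0;
    the swap argument relies on such pairs. *)
Fixpoint regular_steps_rec (k a b : nat) : nat :=
  if b %| a then a %/ b else
  a %/ b + (if k is k'.+1 then regular_steps_rec k' b (a %% b) else 0).+1.

(* The second argument decreases along the recursion, so [b] is enough fuel. *)
Definition regular_steps a b := regular_steps_rec b a b.

Lemma regular_stepsE a b : 0 < b ->
  regular_steps a b =
  if b %| a then a %/ b else a %/ b + (regular_steps b (a %% b)).+1.
Proof.
(* Any two amounts of fuel that bound the divisor give the same count. *)
have fuel k l a' b' : 0 < b' -> b' <= k -> b' <= l ->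
    regular_steps_rec k a' b' = regular_steps_rec l a' b'.
  elim: k l a' b' => [|k IH] [|l] a' b' b_gt0 bk bl; try lia.
  rewrite /=; case: ifPn => // ndvd; congr (_ + _.+1).
  have := ltn_pmod a' b_gt0 => r_lt.
  by apply: IH; [rewrite lt0n | lia | lia].
move=> b_gt0; rewrite /regular_steps -[in LHS](prednK b_gt0) /= prednK //.
case: ifPn => // ndvd; congr (_ + _.+1).
have := ltn_pmod a b_gt0 => r_lt.
by apply: fuel; [rewrite lt0n | lia | lia].
Qed.

Lemma regular_stepsD a b : 0 < b ->
  regular_steps (a + b) b = (regular_steps a b).+1.
Proof.
move=> b_gt0; rewrite [LHS]regular_stepsE // [in RHS]regular_stepsE // modnDr divnDr // divnn b_gt0.
by rewrite dvdn_addl //; case: ifP => _; lia.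
Qed.

Lemma regular_steps_swap a b : 0 < a < b ->
  regular_steps a b = (regular_steps b a).+1.
Proof.
case/andP=> a_gt0 a_lt_b; rewrite regular_stepsE; last by lia.
by rewrite gtnNdvd // divn_small // modn_small.
Qed.

(** Here r and s are complementary remainders modulo r + s. One subtraction on each side leaves the
    pairs (s, r) and (r, s), whose counts differ by a single swap, or agree when r = s. *)
Lemma regular_steps_compl r s : 0 < r -> 0 < s ->
  regular_steps (r + s) r <= (regular_steps (r + s) s).+1.
Proof.
move=> r_gt0 s_gt0; rewrite [in leqLHS]addnC !regular_stepsD //.
case: (ltngtP r s) => [lt_rs|lt_sr|->] //.
- by rewrite (@regular_steps_swap r s) ?r_gt0 //; lia.
- by rewrite (@regular_steps_swap s r) ?s_gt0 //; lia.
Qed.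

Lemma regular_steps_mul b p : 0 < b -> regular_steps (b * p) b = p.
Proof. by move=> b_gt0; rewrite regular_stepsE // dvdn_mulr // mulKn. Qed.

Lemma regular_steps_div b p c : 0 < c < b ->
  regular_steps (b * p + c) b = p + (regular_steps b c).+1.
Proof.
case/andP=> c_gt0 c_lt_b; rewrite regular_stepsE; last by lia.
rewrite dvdn_addr ?dvdn_mulr // gtnNdvd // mulnC modnMDl modn_small //.
by rewrite divnMDl ?divn_small ?addn0 //; lia.
Qed.

Lemma nb_steps_regular a b A :
  run (eq 1%R) a b A -> nb_steps A = regular_steps a b.
Proof.
elim=> {a b A} [b p b_gt0 p_gt1|a b c p s A c_lt_b _ _ <- eq_a rA IH].
  by rewrite nb_steps_last regular_steps_mul.
rewrite (nb_steps_cons _ _ _ rA) IH.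
have -> : a = b * p + c by lia.
by rewrite regular_steps_div // (run_gt0 rA).
Qed.

Lemma regular_steps_le a b B :
  run (fun s => s = 1%R \/ s = (-1)%R) a b B -> regular_steps a b <= nb_steps B.
Proof.
elim=> {a b B} [b p b_gt0 p_gt1|a b c p s B c_lt_b b_lt_a p_gt0 s1 eq_a rB IH].
  by rewrite nb_steps_last regular_steps_mul.
have c_gt0 := run_gt0 rB; rewrite (nb_steps_cons _ _ _ rB).
case: s1 eq_a => -> eq_a.
  have -> : a = b * p + c by lia.
  by rewrite regular_steps_div ?c_gt0 //; lia.
case: p p_gt0 eq_a => // p _ eq_a.
(* Since a = b(p + 1) - c, the regular division has quotient p and remainder b - c. The subtraction
   it saves pays for the extra step allowed by [regular_steps_compl]. *)
have -> : a = b * p + (b - c) by nia.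
rewrite regular_steps_div; last by lia.
have := @regular_steps_compl (b - c) c.
by rewrite subnK ?(ltnW c_lt_b) // subn_gt0 => /(_ c_lt_b c_gt0); lia.
Qed.

(** * Existence and uniqueness of the regular algorithm *)

Lemma regular_run_exists a b : 0 < b < a -> exists A, run (eq 1%R) a b A.
Proof.
elim/ltn_ind: b a => b IH a /andP[b_gt0 b_lt_a].
have r_lt_b := ltn_pmod a b_gt0; have eq_a := divn_eq a b.
have [/dvdnP[p eq_p]|ndvd] := boolP (b %| a).
  exists (EuclidData [:: b * p; b] [:: p] [::]); rewrite eq_p mulnC.
  by apply: run_last => //; nia.
have r_gt0 : 0 < a %% b by rewrite lt0n.
have [|A rA] := IH _ r_lt_b b; first by rewrite r_gt0.
exists (cons_eq a (a %/ b) 1%R A); apply: run_step rA => //.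
- by rewrite divn_gt0 // ltnW.
- by rewrite {1}eq_a; lia.
Qed.

(** Each equation is forced by uniqueness of Euclidean division, and a last equation cannot compete
    with a further step, whose remainder lies strictly between 0 and b. *)
Lemma regular_run_unique a b A B :
  run (eq 1%R) a b A -> run (eq 1%R) a b B -> A = B.
Proof.
move=> rA; elim: rA B => {a b A} [b p b_gt0 p_gt1|
  a b c p s A c_lt_b b_lt_a p_gt0 <- eq_a rA IH] B rB.
  (* The index [b * p] is abstracted to allow case analysis on [rB]. *)
  move E: (b * p) rB => a rB; case: rB b_gt0 E.
  - move=> b' p' _ _ b_gt0 /eqP; rewrite eqn_pmul2l // => /eqP -> //.
  - move=> a' b' c p' s A c_lt_b _ _ <- eq_a /run_gt0 c_gt0 b_gt0 E.
    have : b' %| b' * p' + c by rewrite (_ : _ + c = b' * p) ?dvdn_mulr //; lia.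
    by rewrite dvdn_addr ?dvdn_mulr // gtnNdvd.
have c_gt0 := run_gt0 rA.
case: rB c_lt_b b_lt_a eq_a rA IH => {a b B} [b p' _ _|
  a b c' p' s' B c'_lt_b _ _ <- eq_a' rB] c_lt_b _ eq_a rA IH.
  have : b %| b * p + c by rewrite (_ : _ + c = b * p') ?dvdn_mulr //; lia.
  by rewrite dvdn_addr ?dvdn_mulr // gtnNdvd.
have Ea : a = p * b + c by lia.
have Ea' : a = p' * b + c' by lia.
have b_gt0 : 0 < b by lia.
have Ep : p = p'.
  (* Both quotients equal [a %/ b], as c and c' are less than b. *)
  rewrite -[p]addn0 -(divn_small c_lt_b) -divnMDl // -Ea Ea'.
  by rewrite divnMDl // divn_small // addn0.
have Ec : c = c' by lia.
by rewrite Ep; congr cons_eq; apply: IH; rewrite Ec.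
Qed.

Theorem corollary5p1 (x0 x1 : nat) (x1_gt0 : 0 < x1) (x1_lt_x0 : x1 < x0) :
  (exists! A : euclid_data, regular_euclid x0 x1 A) /\
  (forall A B : euclid_data,
     regular_euclid x0 x1 A -> general_euclid x0 x1 B ->
     nb_steps A <= nb_steps B).
Proof.
split.
  have [|A rA] := @regular_run_exists x0 x1; first by rewrite x1_gt0.
  exists A; split; first exact: regular_of_run.
  by move=> B /run_of_regular; apply: regular_run_unique.
move=> A B /run_of_regular/nb_steps_regular -> gB.
exact/regular_steps_le/(run_of_general gB)/(sgn_pm1 gB).
Qed.
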